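(* Let $\mu\in\mathcal{D}_{\mathrm{alg}}(1,* )$ be an $\eta$-diagonal distribution with determining sequences $(\alpha_n)_{n=1}^\infty$ and $(\beta_n)_{n=1}^\infty$. Then, in the noncommutative probability space $(\mathbb{C}\langle Z,Z^*\rangle,\mu)$, the elements $ZZ^*$ and $Z^*Z$ have $\eta$-series $$\eta_{ZZ^*}(z)=\sum_{n=1}^\infty\alpha_nz^n\quad\text{and}\quad\eta_{Z^*Z}(z)=\sum_{n=1}^\infty\beta_nz^n.$$
   Context: $\mathbb{C}\langle Z,Z^*\rangle$ is the algebra of complex polynomials in two non-commuting variables $Z,Z^*$; $\mathcal{D}_{\mathrm{alg}}(1,* )$ is the set of linear functionals $\mu$ on it with $\mu(1)=1$. $\mathcal{W}^+=\bigsqcup_{n\ge1}\{1,*\}^n$ is the set of non-empty words over $\{1,*\}$, and for $w=(\ell_1,\dots,\ell_n)$ one sets $Z^w=Z^{\ell_1}\cdots Z^{\ell_n}$, $z^w=z^{\ell_1}\cdots z^{\ell_n}$ (non-commuting formal indeterminates $z,z^*$). The moment series of $\mu$ is $M_\mu=\sum_{w\in\mathcal{W}^+}\mu(Z^w)z^w$ and its $\eta$-series is $\eta_\mu=M_\mu(1+M_\mu)^{-1}$. $\mu$ is $\eta$-diagonal if the coefficient of $z^w$ in $\eta_\mu$ is $0$ for every $w$ not of the form $(1,* )^m$ or $( *,1)^m$, $m\ge1$; in that case $\eta_\mu(z,z^* )=\sum_{n\ge1}\alpha_n(zz^* )^n+\sum_{n\ge1}\beta_n(z^*z)^n$, and $(\alpha_n)$,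 $(\beta_n)$ are called the determining sequences of $\mu$. For an element $a$ of a noncommutative probability space $(\mathcal{A},\varphi)$ (unital complex algebra with linear $\varphi$, $\varphi(1)=1$), $M_a(z)=\sum_{n\ge1}\varphi(a^n)z^n\in\mathbb{C}[[z]]$ and $\eta_a(z)=M_a(z)/(1+M_a(z))$. *)

(* Defs.v *)
From HB Require Import structures.
From mathcomp Require Import all_boot all_order all_algebra.
From mathcomp Require Import boolp monalg.
From mathcomp Require Export reals complex.

Set Implicit Arguments.
Unset Strict Implicit.
Unset Printing Implicit Defensive.

Import GRing.Theory.
Local Open Scope ring_scope.

Record fps (K : Type) := Fps { fps_coef : nat -> K }.

HB.instance Definition _ (K : Type) := gen_eqMixin (fps K).
HB.instance Definition _ (K : Type) := gen_choiceMixin (fps K).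

Lemma fpsP (K : Type) (f g : fps K) : fps_coef f =1 fps_coef g -> f = g.
Proof. by case: f g => [f] [g] /= /funext ->. Qed.

Section FpsRing.
Variable K : fieldType.
Implicit Types f g h : fps K.

Definition fps_zero : fps K := Fps (fun=> 0).
Definition fps_opp f := Fps (fun n => - fps_coef f n).
Definition fps_add f g := Fps (fun n => fps_coef f n + fps_coef g n).

Fact fps_addA : associative fps_add.
Proof. by move=> f g h; apply: fpsP => n /=; rewrite addrA. Qed.
Fact fps_addC : commutative fps_add.
Proof. by move=> f g; apply: fpsP => n /=; rewrite addrC. Qed.
Fact fps_add0 : left_id fps_zero fps_add.
Proof. by move=> f; apply: fpsP => n /=; rewrite add0r. Qed.
Fact fps_addN : left_inverse fps_zero fps_opp fps_add.
Proof. by move=> f; apply: fpsP => n /=; rewrite addNr. Qed.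

HB.instance Definition _ :=
  GRing.isZmodule.Build (fps K) fps_addA fps_addC fps_add0 fps_addN.

Definition fps_one : fps K := Fps (fun n => (n == 0)%:R).
Definition fps_mul f g :=
  Fps (fun n => \sum_(k < n.+1) fps_coef f k * fps_coef g (n - k)%N).

Let trunc N f := \poly_(i < N) fps_coef f i.

Let coef_mul N f g n :
  (n < N)%N -> fps_coef (fps_mul f g) n = (trunc N f * trunc N g)`_n.
Proof.
move=> ltnN; rewrite coefM; apply: eq_bigr => -[k /= lek] _.
by rewrite !coef_poly !(leq_ltn_trans _ ltnN) ?leq_subr.
Qed.

Fact fps_mulC : commutative fps_mul.
Proof.
by move=> f g; apply: fpsP => n; rewrite !(@coef_mul n.+1) // mulrC.
Qed.
Fact fps_mulA : associative fps_mul.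
Proof.
move=> f g h; apply: fpsP => n.
have E u v w : fps_coef (fps_mul u (fps_mul v w)) n
    = (trunc n.+1 u * (trunc n.+1 v * trunc n.+1 w))`_n.
  rewrite /= coefM; apply: eq_bigr => -[k /= lek] _.
  rewrite -(@coef_mul n.+1) ?ltnS ?leq_subr //=.
  by rewrite coef_poly lek.
by rewrite E fps_mulC E mulrA mulrC.
Qed.
Fact fps_mul1 : left_id fps_one fps_mul.
Proof.
move=> f; apply: fpsP => n /=; rewrite big_ord_recl /= subn0 mul1r.
by rewrite big1 ?addr0 // => i _; rewrite mul0r.
Qed.
Fact fps_mulDl : left_distributive fps_mul fps_add.
Proof.
move=> f g h; apply: fpsP => n /=; rewrite -big_split.
by apply: eq_bigr => i _; rewrite mulrDl.
Qed.
Fact fps_one_neq0 : fps_one != 0.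
Proof.
by apply/eqP => /(congr1 (fun f => fps_coef f 0%N)) /eqP; rewrite oner_eq0.
Qed.

HB.instance Definition _ := GRing.Zmodule_isComNzRing.Build (fps K)
  fps_mulA fps_mulC fps_mul1 fps_mulDl fps_one_neq0.

(* If f = c (1 - g) with c != 0 and g(0) = 0, then f^-1 = c^-1 \sum_k g^k, and
   the terms k > n do not contribute to the coefficient of z^n. *)
Definition fps_unit : pred (fps K) := fun f => fps_coef f 0%N != 0.
Definition fps_inv f : fps K :=
  let c := fps_coef f 0%N in
  let g : fps K := 1 - Fps (fun n => c^-1 * fps_coef f n) in
  if c == 0 then f
  else Fps (fun n => c^-1 * \sum_(k < n.+1) fps_coef (g ^+ k) n).

Lemma fps_coefD f g n : fps_coef (f + g) n = fps_coef f n + fps_coef g n.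
Proof. by []. Qed.
Lemma fps_coefN f n : fps_coef (- f) n = - fps_coef f n.
Proof. by []. Qed.
Lemma fps_coef0 n : fps_coef (0 : fps K) n = 0.
Proof. by []. Qed.
Lemma fps_coef1 n : fps_coef (1 : fps K) n = (n == 0%N)%:R.
Proof. by []. Qed.
Lemma fps_coefM f g n :
  fps_coef (f * g) n = \sum_(k < n.+1) fps_coef f k * fps_coef g (n - k)%N.
Proof. by []. Qed.
Lemma fps_coef_sum (I : Type) (r : seq I) (P : pred I) (F : I -> fps K) n :
  fps_coef (\sum_(i <- r | P i) F i) n = \sum_(i <- r | P i) fps_coef (F i) n.
Proof. by apply: (big_morph (fun f => fps_coef f n)). Qed.

Lemma fps_coefX_small f k n :
  fps_coef f 0%N = 0 -> (n < k)%N -> fps_coef (f ^+ k) n = 0.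
Proof.
move=> f0; elim: k n => // k IHk n ltnk; rewrite exprS fps_coefM.
apply: big1 => -[[|i] lei] _ /=; first by rewrite f0 mul0r.
by rewrite IHk ?mulr0 //; rewrite ltnS in lei; case: n ltnk lei => // n;
  rewrite ltnS subSS => ltnk _; exact: leq_ltn_trans (leq_subr _ _) ltnk.
Qed.

Fact fps_mulV : {in fps_unit, left_inverse 1 fps_inv *%R}.
Proof.
move=> f; rewrite unfold_in => c0; apply: fpsP => n.
rewrite mulrC /fps_inv (negPf c0).
set c := fps_coef f 0; pose d := Fps (fun m => c^-1 * fps_coef f m).
rewrite -/d; set g := 1 - d.
have g0 : fps_coef g 0%N = 0.
  by rewrite fps_coefD fps_coefN fps_coef1 -[fps_coef d 0]/(c^-1 * c) mulVf ?subrr.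
have -> : fps_coef (1 : fps K) n = fps_coef (d * \sum_(k < n.+1) g ^+ k) n.
  have -> : d = 1 - g by rewrite opprB addrCA subrr addr0.
  rewrite -[X in _ = fps_coef X n]opprK -mulNr opprB -subrX1 opprB.
  by rewrite fps_coefD fps_coefN fps_coefX_small ?subr0.
rewrite !fps_coefM; apply: eq_bigr => -[k /= lek] _.
rewrite fps_coef_sum mulrA [_ * c^-1]mulrC; congr (_ * _).
rewrite -(big_mkord predT (fun i => fps_coef (g ^+ i) (n - k)%N)).
rewrite -(big_mkord predT (fun i => fps_coef (g ^+ i) (n - k)%N)).
rewrite [RHS](@big_cat_nat _ _ _ (n - k).+1) ?ltnS ?leq_subr //=.
rewrite [X in _ + X]big_nat [X in _ + X]big1 ?addr0 // => i /andP[lti _].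
exact: fps_coefX_small.
Qed.
Fact fps_unitP f g : g * f = 1 -> fps_unit f.
Proof.
move=> /(congr1 (fun h => fps_coef h 0%N)).
rewrite fps_coefM big_ord_recl big_ord0 addr0 /= => E.
apply/eqP => f0; move: E; rewrite f0 mulr0 => /eqP.
by rewrite eq_sym oner_eq0.
Qed.
Fact fps_invF : {in [predC fps_unit], fps_inv =1 id}.
Proof. by move=> f; rewrite inE unfold_in negbK /fps_inv => ->. Qed.

HB.instance Definition _ := GRing.ComNzRing_hasMulInverse.Build (fps K)
  fps_mulV fps_unitP fps_invF.

(* \sum_(n >= 1) u_n z^n; the value u 0 is ignored. *)
Definition fps1 (u : nat -> K) : fps K := Fps (fun n => if n is 0 then 0 else u n).

End FpsRing.

(* A series in non-commuting indeterminates indexed by A: ncs_coef f w is the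
   coefficient of z^w, and products are given by concatenation of words. *)
Record ncseries (A K : Type) := NCSeries { ncs_coef : seq A -> K }.

HB.instance Definition _ (A K : Type) := gen_eqMixin (ncseries A K).
HB.instance Definition _ (A K : Type) := gen_choiceMixin (ncseries A K).

Lemma ncsP (A K : Type) (f g : ncseries A K) :
  ncs_coef f =1 ncs_coef g -> f = g.
Proof. by case: f g => [f] [g] /= /funext ->. Qed.

Section NcsRing.
Variables (A : Type) (K : fieldType).
Local Notation ncs := (ncseries A K).
Implicit Types (f g h : ncs) (w : seq A).

Definition ncs_zero : ncs := NCSeries (fun=> 0).
Definition ncs_opp f : ncs := NCSeries (fun w => - ncs_coef f w).
Definition ncs_add f g : ncs := NCSeries (fun w => ncs_coef f w + ncs_coef g w).

Fact ncs_addA : associative ncs_add.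
Proof. by move=> f g h; apply: ncsP => w /=; rewrite addrA. Qed.
Fact ncs_addC : commutative ncs_add.
Proof. by move=> f g; apply: ncsP => w /=; rewrite addrC. Qed.
Fact ncs_add0 : left_id ncs_zero ncs_add.
Proof. by move=> f; apply: ncsP => w /=; rewrite add0r. Qed.
Fact ncs_addN : left_inverse ncs_zero ncs_opp ncs_add.
Proof. by move=> f; apply: ncsP => w /=; rewrite addNr. Qed.

HB.instance Definition _ :=
  GRing.isZmodule.Build ncs ncs_addA ncs_addC ncs_add0 ncs_addN.

Definition ncs_one : ncs := NCSeries (fun w => (nilp w)%:R).
Definition ncs_mul f g : ncs := NCSeries (fun w =>
  \sum_(k < (size w).+1) ncs_coef f (take k w) * ncs_coef g (drop k w)).

Let shift a f : ncs := NCSeries (fun w => ncs_coef f (a :: w)).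

Let coef_mul_nil f g :
  ncs_coef (ncs_mul f g) [::] = ncs_coef f [::] * ncs_coef g [::].
Proof. by rewrite /= big_ord_recl big_ord0 addr0. Qed.

Let coef_mul_cons f g a w :
  ncs_coef (ncs_mul f g) (a :: w)
  = ncs_coef f [::] * ncs_coef g (a :: w) + ncs_coef (ncs_mul (shift a f) g) w.
Proof. by rewrite /= big_ord_recl. Qed.

Fact ncs_mulA : associative ncs_mul.
Proof.
move=> f g h; apply: ncsP => w; elim: w f => [|a w IHw] f.
  by rewrite !coef_mul_nil mulrA.
rewrite !coef_mul_cons coef_mul_nil IHw.
have -> : ncs_coef (ncs_mul (shift a (ncs_mul f g)) h) w
    = ncs_coef f [::] * ncs_coef (ncs_mul (shift a g) h) w
      + ncs_coef (ncs_mul (ncs_mul (shift a f) g) h) w.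
  rewrite [X in _ = _ * X + _]/= [X in _ = _ + X]/= mulr_sumr -big_split.
  apply: eq_bigr => k _; rewrite -[ncs_coef (shift _ _) _]/(ncs_coef _ (_ :: _)).
  by rewrite coef_mul_cons mulrDl mulrA.
by rewrite mulrDr mulrA addrA.
Qed.
Fact ncs_mul1 : left_id ncs_one ncs_mul.
Proof.
move=> f; apply: ncsP => w /=; rewrite big_ord_recl take0 drop0 mul1r.
rewrite big1 ?addr0 // => k _; case: w k => [|a w] k; last by rewrite mul0r.
by case: k.
Qed.
Fact ncs_mulr1 : right_id ncs_one ncs_mul.
Proof.
move=> f; apply: ncsP => w /=; rewrite big_ord_recr /= take_size drop_size mulr1.
rewrite big1 ?add0r // => -[i lti] _ /=.
by rewrite /nilp size_drop subn_eq0 leqNgt lti mulr0.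
Qed.
Fact ncs_mulDl : left_distributive ncs_mul ncs_add.
Proof.
move=> f g h; apply: ncsP => w /=; rewrite -big_split.
by apply: eq_bigr => i _; rewrite mulrDl.
Qed.
Fact ncs_mulDr : right_distributive ncs_mul ncs_add.
Proof.
move=> f g h; apply: ncsP => w /=; rewrite -big_split.
by apply: eq_bigr => i _; rewrite mulrDr.
Qed.
Fact ncs_one_neq0 : ncs_one != 0.
Proof.
by apply/eqP => /(congr1 (fun f => ncs_coef f [::])) /eqP; rewrite oner_eq0.
Qed.

HB.instance Definition _ := GRing.Zmodule_isNzRing.Build ncs
  ncs_mulA ncs_mul1 ncs_mulr1 ncs_mulDl ncs_mulDr ncs_one_neq0.

Lemma ncs_coefD f g w : ncs_coef (f + g) w = ncs_coef f w + ncs_coef g w.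
Proof. by []. Qed.
Lemma ncs_coefN f w : ncs_coef (- f) w = - ncs_coef f w.
Proof. by []. Qed.
Lemma ncs_coef0 w : ncs_coef (0 : ncs) w = 0.
Proof. by []. Qed.
Lemma ncs_coef1 w : ncs_coef (1 : ncs) w = (nilp w)%:R.
Proof. by []. Qed.
Lemma ncs_coefM f g w : ncs_coef (f * g) w
  = \sum_(k < (size w).+1) ncs_coef f (take k w) * ncs_coef g (drop k w).
Proof. by []. Qed.
Lemma ncs_coef_sum (I : Type) (r : seq I) (P : pred I) (F : I -> ncs) w :
  ncs_coef (\sum_(i <- r | P i) F i) w = \sum_(i <- r | P i) ncs_coef (F i) w.
Proof. by apply: (big_morph (fun f => ncs_coef f w)). Qed.

(* Same geometric series as for fps_inv. *)
Definition ncs_unit : pred ncs := fun f => ncs_coef f [::] != 0.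
Definition ncs_inv f : ncs :=
  let c := ncs_coef f [::] in
  let g : ncs := 1 - NCSeries (fun w => c^-1 * ncs_coef f w) in
  if c == 0 then f else
  NCSeries (fun w => c^-1 * \sum_(k < (size w).+1) ncs_coef (g ^+ k) w).

Lemma ncs_coefX_small f k w :
  ncs_coef f [::] = 0 -> (size w < k)%N -> ncs_coef (f ^+ k) w = 0.
Proof.
move=> f0; elim: k w => // k IHk w ltnk; rewrite exprS ncs_coefM.
apply: big1 => -[[|i] lei] _ /=; first by rewrite take0 f0 mul0r.
rewrite IHk ?mulr0 // size_drop; case: w ltnk lei => // a w.
by rewrite !ltnS /= subSS => ltnk _; exact: leq_ltn_trans (leq_subr _ _) ltnk.
Qed.

Let geom f N w : ncs_coef f [::] = 0 -> (size w < N)%N ->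
  \sum_(k < (size w).+1) ncs_coef (f ^+ k) w
  = ncs_coef (\sum_(k < N) f ^+ k) w.
Proof.
move=> f0 ltwN; rewrite ncs_coef_sum.
rewrite -!(big_mkord predT (fun i => ncs_coef (f ^+ i) w)).
rewrite [RHS](@big_cat_nat _ _ _ (size w).+1) //=.
rewrite [X in _ + X]big_nat [X in _ + X]big1 ?addr0 // => i /andP[lti _].
exact: ncs_coefX_small.
Qed.

Let norm_nil f (g := 1 - NCSeries (fun w => (ncs_coef f [::])^-1 * ncs_coef f w)) :
  ncs_coef f [::] != 0 -> ncs_coef g [::] = 0.
Proof.
move=> c0; rewrite ncs_coefD ncs_coefN ncs_coef1.
by rewrite -[ncs_coef (NCSeries _) _]/(_ * _) mulVf ?subrr.
Qed.

Fact ncs_mulV : {in ncs_unit, left_inverse 1 ncs_inv *%R}.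
Proof.
move=> f; rewrite unfold_in => c0; apply: ncsP => w.
have := norm_nil c0; rewrite /ncs_inv (negPf c0).
set c := ncs_coef f [::]; pose d : ncs := NCSeries (fun m => c^-1 * ncs_coef f m).
rewrite -/d; set g : ncs := 1 - d => g0; set N := (size w).+1.
have -> : ncs_coef (1 : ncs) w = ncs_coef ((\sum_(k < N) g ^+ k) * d) w.
  have -> : d = 1 - g by rewrite opprB addrCA subrr addr0.
  have C : GRing.comm (\sum_(k < N) g ^+ k) (1 - g).
    apply: commr_sym; apply: commr_sum => i _; apply: commr_sym.
    by apply: commrB; [exact: commr1 | apply: commr_sym; exact: commrX].
  rewrite C -[1 - g]opprB mulNr -subrX1 opprB.
  by rewrite ncs_coefD ncs_coefN ncs_coefX_small ?subr0.
rewrite !ncs_coefM; apply: eq_bigr => -[k /= lek] _.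
rewrite -(@geom g N) ?size_takel //.
by rewrite mulrA [_ * c^-1]mulrC.
Qed.
Fact ncs_divV : {in ncs_unit, right_inverse 1 ncs_inv *%R}.
Proof.
move=> f; rewrite unfold_in => c0; apply: ncsP => w.
have := norm_nil c0; rewrite /ncs_inv (negPf c0).
set c := ncs_coef f [::]; pose d : ncs := NCSeries (fun m => c^-1 * ncs_coef f m).
rewrite -/d; set g : ncs := 1 - d => g0; set N := (size w).+1.
have -> : ncs_coef (1 : ncs) w = ncs_coef (d * \sum_(k < N) g ^+ k) w.
  have -> : d = 1 - g by rewrite opprB addrCA subrr addr0.
  rewrite -[1 - g]opprB mulNr -subrX1 opprB.
  by rewrite ncs_coefD ncs_coefN ncs_coefX_small ?subr0.
rewrite !ncs_coefM; apply: eq_bigr => -[k /= lek] _.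
rewrite -(@geom g N) ?size_drop ?ltnS ?leq_subr //.
by rewrite mulrA [_ * c^-1]mulrC.
Qed.
Fact ncs_unitP f g : g * f = 1 /\ f * g = 1 -> ncs_unit f.
Proof.
move=> [/(congr1 (fun h => ncs_coef h [::])) + _].
rewrite ncs_coefM big_ord_recl big_ord0 addr0 /= => E.
apply/eqP => f0; move: E; rewrite f0 mulr0 => /eqP.
by rewrite eq_sym oner_eq0.
Qed.
Fact ncs_invF : {in [predC ncs_unit], ncs_inv =1 id}.
Proof. by move=> f; rewrite inE unfold_in negbK /ncs_inv => ->. Qed.

HB.instance Definition _ := GRing.NzRing_hasMulInverse.Build ncs
  ncs_mulV ncs_divV ncs_unitP ncs_invF.

End NcsRing.

Variant letter := One | Star.

Definition bool_of_letter l := if l is Star then true else false.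
Definition letter_of_bool b := if b then Star else One.
Fact bool_of_letterK : cancel bool_of_letter letter_of_bool.
Proof. by case. Qed.
HB.instance Definition _ := Finite.copy letter (can_type bool_of_letterK).

(* C<Z,Z*>: the monoid algebra of the free monoid on {One, Star}.  The alias
   carries the algType structure, which monalg only provides over commutative
   monoids. *)
Definition ncpoly (K : fieldType) := {malg K[{fmonom letter}]}.

HB.instance Definition _ (K : fieldType) := GRing.Lalgebra.on (ncpoly K).

Fact ncpoly_scaleAr (K : fieldType) (c : K) (p q : ncpoly K) :
  c *: (p * q) = p * (c *: q).
Proof.
apply/malgP => m; rewrite mcoeffZ mcoeffMl mulr_sumr.
rewrite (mcoeffMlw m (finmap.fsubset_refl _) (msuppZ_le c q)).
apply: eq_bigr => u _; rewrite mulr_sumr; apply: eq_bigr => v _.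
by rewrite mcoeffZ mulrnAr mulrCA.
Qed.

HB.instance Definition _ (K : fieldType) :=
  GRing.Lalgebra_isAlgebra.Build K (ncpoly K) (@ncpoly_scaleAr K).

Section Distributions.
Variable K : fieldType.

Definition Zl (l : letter) : ncpoly K := << fmu l >>.
Definition Z : ncpoly K := Zl One.
Definition Zs : ncpoly K := Zl Star.
Definition Zw (w : seq letter) : ncpoly K := \prod_(l <- w) Zl l.

Definition nc_moment_series (mu : {scalar ncpoly K}) : ncseries letter K :=
  NCSeries (fun w => if w is [::] then 0 else mu (Zw w)).
Definition nc_eta_series (mu : {scalar ncpoly K}) : ncseries letter K :=
  let M := nc_moment_series mu in M / (1 + M).

Definition word_1s (m : nat) : seq letter := flatten (nseq m [:: One; Star]).
Definition word_s1 (m : nat) : seq letter := flatten (nseq m [:: Star; One]).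

Definition eta_diagonal (mu : {scalar ncpoly K}) : Prop :=
  forall w : seq letter, w <> [::] ->
    (forall m : nat, (1 <= m)%N -> w <> word_1s m /\ w <> word_s1 m) ->
    ncs_coef (nc_eta_series mu) w = 0.

(* The sequences are indexed by n >= 1: alpha 0 and beta 0 are unconstrained. *)
Definition determining_sequences (mu : {scalar ncpoly K}) (alpha beta : nat -> K) :
    Prop :=
  forall n : nat, (1 <= n)%N ->
    ncs_coef (nc_eta_series mu) (word_1s n) = alpha n /\
    ncs_coef (nc_eta_series mu) (word_s1 n) = beta n.

End Distributions.

Record ncProbSpace (K : fieldType) := NCProbSpace {
  nc_alg :> algType K;
  nc_state : {scalar nc_alg};
  nc_state1 : nc_state 1 = 1 }.

Definition moment_series (K : fieldType) (P : ncProbSpace K) (a : P) : fps K :=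
  fps1 (fun n => nc_state P (a ^+ n)).
Definition eta_series (K : fieldType) (P : ncProbSpace K) (a : P) : fps K :=
  let M := moment_series a in M / (1 + M).

Definition ncpoly_space (K : fieldType) (mu : {scalar ncpoly K}) (mu1 : mu 1 = 1) :
  ncProbSpace K := NCProbSpace mu1.

(* Main.v *)
Require Import Defs.
From mathcomp Require Import all_boot all_order all_algebra.
From mathcomp Require Import reals complex.

Set Implicit Arguments.
Unset Strict Implicit.
Unset Printing Implicit Defensive.

Import GRing.Theory.
Local Open Scope ring_scope.

(** Restricting a non-commutative series to the powers of a fixed word [u], i.e.
    reading off the coefficients of [z^(u^n)], gives a one-variable series. A
    prefix of [u^n] whose length is a multiple of [size u] is a power of [u], and
    so is the remaining suffix. Hence restriction is multiplicative on products
    [f * g] where [f] is supported on words of length divisible by [size u]. An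
    eta-diagonal eta-series is supported on words of even length, so for [u] of
    length 2 the relation [eta * (1 + M) = M] restricts to the relation defining
    the eta-series of [Z^u]. *)

Definition word_pow (A : Type) (u : seq A) n : seq A := flatten (nseq n u).

Lemma size_word_pow (A : Type) (u : seq A) n :
  size (word_pow u n) = (n * size u)%N.
Proof. by rewrite size_flatten /shape map_nseq sumn_nseq mulnC. Qed.

Lemma word_powD (A : Type) (u : seq A) m n :
  word_pow u (m + n) = word_pow u m ++ word_pow u n.
Proof. by rewrite /word_pow nseqD flatten_cat. Qed.

Lemma sum_multiples (V : nmodType) d n (F : nat -> V) :
  (0 < d)%N -> (forall k, ~~ (d %| k)%N -> F k = 0) ->
  \sum_(k < (n * d).+1) F k = \sum_(j < n.+1) F (j * d)%N.
Proof.
move=> d_gt0 F0; elim: n => [|n IHn]; first by rewrite !big_ord1.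
rewrite [RHS]big_ord_recr -IHn /= -!(big_mkord predT F).
rewrite (@big_cat_nat _ _ _ (n * d).+1) //=; last first.
  by rewrite ltnS leq_mul2r leqnSn orbT.
(* Among the new indices [n * d < k <= n.+1 * d] only the last is a multiple of [d]. *)
congr (_ + _); rewrite big_nat_recr /=; last by rewrite ltn_pmul2r.
rewrite big_nat big1 ?add0r // => k /andP[ltk kltn]; apply: F0.
apply/negP => /dvdnP[q kE]; move: ltk kltn.
by rewrite kE !ltn_pmul2r // ltnS => /leq_trans le /le; rewrite ltnn.
Qed.

Section Restriction.
Variables (A : Type) (K : fieldType).
Implicit Types f g : ncseries A K.

Definition ncs_restrict (u : seq A) f : fps K :=
  Fps (fun n => ncs_coef f (word_pow u n)).

Lemma ncs_restrictD u f g :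
  ncs_restrict u (f + g) = ncs_restrict u f + ncs_restrict u g.
Proof. by []. Qed.

Lemma ncs_restrict1 u : (0 < size u)%N -> ncs_restrict u 1 = 1.
Proof.
move=> u_gt0; apply: fpsP => n.
by rewrite /= /nilp size_word_pow muln_eq0 [size u == 0]gtn_eqF ?orbF.
Qed.

Lemma ncs_restrictM u f g : (0 < size u)%N ->
  (forall w, ~~ (size u %| size w)%N -> ncs_coef f w = 0) ->
  ncs_restrict u (f * g) = ncs_restrict u f * ncs_restrict u g.
Proof.
move=> u_gt0 f0; apply: fpsP => n; rewrite fps_coefM /= size_word_pow.
(* For larger [k], [take] returns the whole word, where [f] need not vanish; the cutoff makes [F]
   vanish at every non-multiple of [size u]. *)
pose F k := if (k <= n * size u)%N then
  ncs_coef f (take k (word_pow u n)) * ncs_coef g (drop k (word_pow u n)) else 0.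
transitivity (\sum_(k < (n * size u).+1) F k).
  by apply: eq_bigr => k _; rewrite /F -ltnS ltn_ord.
rewrite (@sum_multiples _ (size u) n F) // => [|k kP].
  apply: eq_bigr => j _; have le_jn : (j <= n)%N by rewrite -ltnS.
  rewrite /F leq_mul2r le_jn orbT.
  have -> : word_pow u n = word_pow u j ++ word_pow u (n - j).
    by rewrite -word_powD subnKC.
  by rewrite take_size_cat ?drop_size_cat ?size_word_pow.
rewrite /F; case: ifP => // le_k.
by rewrite f0 ?mul0r // size_takel ?size_word_pow.
Qed.

End Restriction.

(** A zero constant term makes [1 + f] invertible, so the relation determines [g]. *)
Lemma fps_div_1D (K : fieldType) (f g : fps K) :
  fps_coef f 0 = 0 -> g * (1 + f) = f -> f / (1 + f) = g.
Proof.
move=> f0 {1}<-; apply: mulrK.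
by rewrite unfold_in /= /fps_unit fps_coefD fps_coef1 f0 addr0 oner_neq0.
Qed.

Lemma ncs_div_1DK (A : Type) (K : fieldType) (f : ncseries A K) :
  ncs_coef f [::] = 0 -> f / (1 + f) * (1 + f) = f.
Proof.
move=> f0; apply: mulrVK.
by rewrite unfold_in /= /ncs_unit ncs_coefD ncs_coef1 f0 addr0 oner_neq0.
Qed.

Lemma Zw_pow (K : fieldType) (u : seq letter) n :
  Zw K (word_pow u n) = Zw K u ^+ n.
Proof. by rewrite /Zw /word_pow big_flatten big_nseq iter_mulr_1. Qed.

Section EtaSeries.
Variables (K : fieldType) (mu : {scalar ncpoly K}) (mu1 : mu 1 = 1).

Lemma restrict_moment_series u : (0 < size u)%N ->
  ncs_restrict u (nc_moment_series mu)
  = moment_series (P := ncpoly_space mu1) (Zw K u).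
Proof.
move=> u_gt0; apply: fpsP => -[|n] //=.
rewrite -[_ ^+ n.+1](Zw_pow K u n.+1).
(* A positive power of a non-empty word is non-empty, which avoids the default value 0 at [[::]]. *)
by case: (word_pow u n.+1) (size_word_pow u n.+1) => //=; case: size u_gt0.
Qed.

Lemma eta_diagonal_odd w :
  eta_diagonal mu -> odd (size w) -> ncs_coef (nc_eta_series mu) w = 0.
Proof.
move=> mu_diag w_odd; apply: mu_diag => [w0|m _]; first by rewrite w0 in w_odd.
(* Both [word_1s m] and [word_s1 m] are, by conversion, powers of a two-letter word. *)
have even_pow a b : odd (size (word_pow [:: a; b] m : seq letter)) = false.
  by rewrite size_word_pow muln2 odd_double.
by split=> w_alt; move: w_odd; rewrite w_alt even_pow.
Qed.

Lemma restrict_eta_series u : eta_diagonal mu -> size u = 2 ->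
  eta_series (P := ncpoly_space mu1) (Zw K u)
  = ncs_restrict u (nc_eta_series mu).
Proof.
move=> mu_diag u2; have u_gt0 : (0 < size u)%N by rewrite u2.
apply: fps_div_1D => //.
rewrite -restrict_moment_series // -(ncs_restrict1 K u_gt0) -ncs_restrictD.
(* The eta-series is the left factor, the one whose support must consist of even-length words. *)
rewrite -ncs_restrictM // => [|w]; first by rewrite ncs_div_1DK.
by rewrite u2 dvdn2 negbK; apply: eta_diagonal_odd.
Qed.

Lemma nc_eta_series_nil : ncs_coef (nc_eta_series mu) [::] = 0.
Proof. by rewrite ncs_coefM big_ord1 mul0r. Qed.

End EtaSeries.

Theorem proposition2p13 (R : realType) (mu : {scalar ncpoly R[i]})
    (mu1 : mu 1 = 1) (alpha beta : nat -> R[i])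
    (mu_diag : eta_diagonal mu)
    (mu_det : determining_sequences mu alpha beta) :
  eta_series (P := ncpoly_space mu1) (Z R[i] * Zs R[i]) = fps1 alpha /\
  eta_series (P := ncpoly_space mu1) (Zs R[i] * Z R[i]) = fps1 beta.
Proof.
have Zw2 a b : Zl R[i] a * Zl R[i] b = Zw R[i] [:: a; b].
  by rewrite /Zw big_cons big_seq1.
split; rewrite [_ * _]Zw2 restrict_eta_series //;
  (* The constant term is treated apart, since [alpha 0] and [beta 0] are arbitrary. *)
  apply: fpsP => -[|n] /=; first [exact: nc_eta_series_nil | by case: (mu_det n.+1)].
Qed.
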